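(* Let $w = (\mathcal{C}_{w \le 0}, \mathcal{C}_{w \ge 0})$ be a weight structure on a triangulated category $\mathcal{C}$, with heart $\mathcal{C}_{w=0}$. (a) The inclusion of the heart $\iota_- : \mathcal{C}_{w=0} \hookrightarrow \mathcal{C}_{w \le 0, \ne -1}$ admits a left adjoint $$\mathrm{Gr}_0 : \mathcal{C}_{w \le 0, \ne -1} \longrightarrow \mathcal{C}_{w=0} .$$ On objects, it is given by sending $M$ to the term $M_{\ge 0}$ of a weight filtration $$M_{\le -2} \longrightarrow M \longrightarrow M_{\ge 0} \longrightarrow M_{\le -2}[1]$$ avoiding weight $-1$. The composition $\mathrm{Gr}_0 \circ \iota_-$ equals the identity on $\mathcal{C}_{w=0}$. (b) The inclusion of the heart $\iota_+ : \mathcal{C}_{w=0} \hookrightarrow \mathcal{C}_{w \ge 0, \ne 1}$ admits a right adjoint $$\mathrm{Gr}_0 : \mathcal{C}_{w \ge 0, \ne 1} \longrightarrow \mathcal{C}_{w=0} .$$ On objects, it is given by sending $M$ to the term $M_{\le 0}$ of a weight filtration $$M_{\le 0} \longrightarrow M \longrightarrow M_{\ge 2} \longrightarrow M_{\le 0}[1]$$ avoiding weight $1$. The composition $\mathrm{Gr}_0 \circ \iota_+$ equals the identity on $\mathcal{C}_{w=0}$.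
   Context: A weight structure on a triangulated category $\mathcal{C}$ is a pair $w=(\mathcal{C}_{w\le 0},\mathcal{C}_{w\ge 0})$ of full subcategories such that, putting $\mathcal{C}_{w\le n}:=\mathcal{C}_{w\le 0}[n]$ and $\mathcal{C}_{w\ge n}:=\mathcal{C}_{w\ge 0}[n]$ for $n\in\mathbb{Z}$: (1) $\mathcal{C}_{w\le 0}$ and $\mathcal{C}_{w\ge 0}$ are closed under direct summands formed in $\mathcal{C}$; (2) $\mathcal{C}_{w\le 0}\subset\mathcal{C}_{w\le 1}$ and $\mathcal{C}_{w\ge 1}\subset\mathcal{C}_{w\ge 0}$; (3) $\mathrm{Hom}_{\mathcal{C}}(M,N)=0$ for all $M\in\mathcal{C}_{w\le 0}$, $N\in\mathcal{C}_{w\ge 1}$; (4) for every $M\in\mathcal{C}$ there is an exact triangle $A\to M\to B\to A[1]$ with $A\in\mathcal{C}_{w\le 0}$, $B\in\mathcal{C}_{w\ge 1}$. The heart $\mathcal{C}_{w=0}$ is the full subcategory of objects lying in both $\mathcal{C}_{w\le 0}$ and $\mathcal{C}_{w\ge 0}$. For integers $m\le n$, a weight filtration of $M$ avoiding weights $m,\dots,n$ is an exact triangle $M_{\le m-1}\to M\to M_{\ge n+1}\to M_{\le m-1}[1]$ with $M_{\le m-1}\in\mathcal{C}_{w\le m-1}$ and $M_{\ge n+1}\in\mathcal{C}_{w\ge n+1}$. The object $M$ is without weights $m,\dots,n$ if it admits such a weight filtration (it is then unique up to unique isomorphism). $\mathcal{C}_{w\le 0,\ne -1}$ is the full subcategory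 of $\mathcal{C}_{w\le 0}$ of objects without weight $-1$; $\mathcal{C}_{w\ge 0,\ne 1}$ is the full subcategory of $\mathcal{C}_{w\ge 0}$ of objects without weight $1$. *)

(* Defs.v *)
From HB Require Import structures.
From mathcomp Require Import all_boot all_order all_algebra.
Set Implicit Arguments.
Unset Strict Implicit.
Unset Printing Implicit Defensive.
Import Order.TTheory GRing.Theory Num.Theory.
Local Open Scope ring_scope.

Record category := Category {
  obj :> Type;
  mor : obj -> obj -> Type;
  idm : forall X, mor X X;
  compm : forall X Y Z, mor Y Z -> mor X Y -> mor X Z;
  comp1m : forall X Y (f : mor X Y), compm (idm Y) f = f;
  compm1 : forall X Y (f : mor X Y), compm f (idm X) = f;
  compA : forall X Y Z T (h : mor Z T) (g : mor Y Z) (f : mor X Y),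
    compm h (compm g f) = compm (compm h g) f
}.
Arguments idm {c} X.

Notation "g \oc f" := (compm g f) (at level 40, left associativity).

Definition is_iso (C : category) (X Y : C) (f : mor X Y) : Prop :=
  exists g : mor Y X, g \oc f = idm X /\ f \oc g = idm Y.

Definition isomorphic (C : category) (X Y : C) : Prop :=
  exists f : mor X Y, is_iso f.

Record functor (C D : category) := Functor {
  fobj :> C -> D;
  fmap : forall X Y : C, mor X Y -> mor (fobj X) (fobj Y);
  fmap1 : forall X : C, fmap (idm X) = idm (fobj X);
  fmapM : forall (X Y Z : C) (g : mor Y Z) (f : mor X Y),
    fmap (g \oc f) = fmap g \oc fmap f
}.

Definition functor_id (C : category) : functor C C :=
  @Functor C C id (fun _ _ f => f) (fun _ => erefl) (fun _ _ _ _ _ => erefl).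

Section FunctorComp.
Variables (C D E : category) (G : functor D E) (F : functor C D).

Lemma functor_comp1 (X : C) : fmap G (fmap F (idm X)) = idm (G (F X)).
Proof. by rewrite !fmap1. Qed.

Lemma functor_compM (X Y Z : C) (g : mor Y Z) (f : mor X Y) :
  fmap G (fmap F (g \oc f)) = fmap G (fmap F g) \oc fmap G (fmap F f).
Proof. by rewrite !fmapM. Qed.

Definition functor_comp : functor C E :=
  @Functor C E (fun X => G (F X)) (fun _ _ f => fmap G (fmap F f))
    functor_comp1 functor_compM.
End FunctorComp.

Definition natural_iso (C D : category) (F G : functor C D) : Prop :=
  exists2 eta : forall X : C, mor (F X) (G X),
    forall X, is_iso (eta X)
    & forall (X Y : C) (f : mor X Y),
        fmap G f \oc eta X = eta Y \oc fmap F f.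

(* [left_adjoint F G]: F is left adjoint to G, i.e. G is right adjoint to F *)
Definition left_adjoint (C D : category) (F : functor C D) (G : functor D C)
    : Prop :=
  exists2 phi : forall (X : C) (Y : D), mor (F X) Y -> mor X (G Y),
    forall X Y, bijective (@phi X Y)
    & forall (X X' : C) (Y Y' : D)
             (a : mor X' X) (f : mor (F X) Y) (b : mor Y Y'),
        phi X' Y' (b \oc f \oc fmap F a) = fmap G b \oc phi X Y f \oc a.

Definition full_subcat (C : category) (P : C -> Prop) : category :=
  @Category {X : C | P X}
    (fun X Y => mor (sval X) (sval Y))
    (fun X => idm (sval X))
    (fun _ _ _ g f => g \oc f)
    (fun _ _ f => comp1m f)
    (fun _ _ f => compm1 f)
    (fun _ _ _ _ h g f => compA h g f).

Definition full_incl (C : category) (P Q : C -> Prop)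
    (sPQ : forall X, P X -> Q X) : functor (full_subcat P) (full_subcat Q) :=
  @Functor (full_subcat P) (full_subcat Q)
    (fun X => exist Q (sval X) (sPQ (sval X) (svalP X)))
    (fun _ _ f => f) (fun _ => erefl) (fun _ _ _ _ _ => erefl).

(* The group laws on morphisms are declared here and the remaining axioms,
   stated with the notation of [zmodType], in [additive_category]. *)
Record zmod_category := ZmodCategory {
  zmod_cat :> category;
  mor_zmod : forall X Y : zmod_cat, GRing.Zmodule (mor X Y)
}.

HB.instance Definition _ (C : zmod_category) (X Y : C) := mor_zmod X Y.

(* Since the groups [mor X Z] and [mor Z X] contain [0], this says that [Z] is
   both initial and terminal. *)
Definition is_zero_object (C : zmod_category) (Z : C) : Prop :=
  (forall (X : C) (f : mor X Z), f = 0) /\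
  (forall (X : C) (f : mor Z X), f = 0).

Definition is_biproduct (C : zmod_category) (X Y P : C)
    (i1 : mor X P) (i2 : mor Y P) (p1 : mor P X) (p2 : mor P Y) : Prop :=
  [/\ p1 \oc i1 = idm X, p2 \oc i2 = idm Y, p2 \oc i1 = 0, p1 \oc i2 = 0
    & i1 \oc p1 + i2 \oc p2 = idm P].

Definition direct_summand (C : zmod_category) (X P : C) : Prop :=
  exists (Y : C) (i1 : mor X P) (i2 : mor Y P) (p1 : mor P X) (p2 : mor P Y),
    is_biproduct i1 i2 p1 p2.

Record additive_category := AdditiveCategory {
  add_cat :> zmod_category;
  compmDl : forall (X Y Z : add_cat) (g1 g2 : mor Y Z) (f : mor X Y),
    (g1 + g2) \oc f = g1 \oc f + g2 \oc f;
  compmDr : forall (X Y Z : add_cat) (g : mor Y Z) (f1 f2 : mor X Y),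
    g \oc (f1 + f2) = g \oc f1 + g \oc f2;
  has_zero_object : exists Z : add_cat, is_zero_object Z;
  has_biproducts : forall X Y : add_cat,
    exists (P : add_cat)
           (i1 : mor X P) (i2 : mor Y P) (p1 : mor P X) (p2 : mor P Y),
      is_biproduct i1 i2 p1 p2
}.

(* Verdier's axioms.  The shift is an additive auto-equivalence, with
   quasi-inverse [tunshift]; it is not assumed to be a strict automorphism.
   [exact_triangle u v d] says that X -u-> Y -v-> Z -d-> X[1] is exact. *)
Record triangulated_category := TriangulatedCategory {
  tri_cat :> additive_category;
  tshift : functor tri_cat tri_cat;
  tunshift : functor tri_cat tri_cat;
  shiftK : natural_iso (functor_comp tunshift tshift) (functor_id tri_cat);
  unshiftK : natural_iso (functor_comp tshift tunshift) (functor_id tri_cat);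
  shiftD : forall (X Y : tri_cat) (f g : mor X Y),
    fmap tshift (f + g) = fmap tshift f + fmap tshift g;
  exact_triangle : forall X Y Z : tri_cat,
    mor X Y -> mor Y Z -> mor Z (tshift X) -> Prop;
  (* TR1 *)
  exact_id : forall X Z : tri_cat, is_zero_object Z ->
    exact_triangle (idm X) (0 : mor X Z) (0 : mor Z (tshift X));
  exact_iso : forall (X Y Z X' Y' Z' : tri_cat)
      (u : mor X Y) (v : mor Y Z) (d : mor Z (tshift X))
      (u' : mor X' Y') (v' : mor Y' Z') (d' : mor Z' (tshift X'))
      (a : mor X X') (b : mor Y Y') (c : mor Z Z'),
    is_iso a -> is_iso b -> is_iso c ->
    b \oc u = u' \oc a -> c \oc v = v' \oc b ->
    fmap tshift a \oc d = d' \oc c ->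
    exact_triangle u v d -> exact_triangle u' v' d';
  exact_cone : forall (X Y : tri_cat) (u : mor X Y),
    exists (Z : tri_cat) (v : mor Y Z) (d : mor Z (tshift X)),
      exact_triangle u v d;
  (* TR2 *)
  exact_rotate : forall (X Y Z : tri_cat)
      (u : mor X Y) (v : mor Y Z) (d : mor Z (tshift X)),
    exact_triangle u v d <-> exact_triangle v d (- fmap tshift u);
  (* TR3 *)
  exact_complete : forall (X Y Z X' Y' Z' : tri_cat)
      (u : mor X Y) (v : mor Y Z) (d : mor Z (tshift X))
      (u' : mor X' Y') (v' : mor Y' Z') (d' : mor Z' (tshift X'))
      (a : mor X X') (b : mor Y Y'),
    exact_triangle u v d -> exact_triangle u' v' d' -> b \oc u = u' \oc a ->
    exists c : mor Z Z', c \oc v = v' \oc b /\ fmap tshift a \oc d = d' \oc c;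
  (* TR4, the octahedral axiom *)
  exact_octahedron : forall (X Y Z X' Y' Z' : tri_cat)
      (f : mor X Y) (f' : mor Y Z') (f'' : mor Z' (tshift X))
      (g : mor Y Z) (g' : mor Z X') (g'' : mor X' (tshift Y))
      (h' : mor Z Y') (h'' : mor Y' (tshift X)),
    exact_triangle f f' f'' -> exact_triangle g g' g'' ->
    exact_triangle (g \oc f) h' h'' ->
    exists (a : mor Z' Y') (b : mor Y' X'),
      exact_triangle a b (fmap tshift f' \oc g'') /\
      [/\ a \oc f' = h' \oc g, b \oc h' = g', h'' \oc a = f''
        & g'' \oc b = fmap tshift f \oc h'']
}.

Section WeightStructures.
Variable C : triangulated_category.
Implicit Types (P : C -> Prop) (M A B X : C) (m n : int).

(* X[n] *)
Definition shiftz n X : C :=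
  match n with
  | Posz k => iter k (tshift C) X
  | Negz k => iter k.+1 (tunshift C) X
  end.

(* The full subcategory P[n]; as the shift is only an equivalence, it is taken
   to be closed under isomorphism. *)
Definition shifted P n M : Prop :=
  exists2 X : C, P X & isomorphic M (shiftz n X).

Record weight_structure := WeightStructure {
  wle0 : C -> Prop;
  wge0 : C -> Prop;
  wle0_summand : forall X M, direct_summand X M -> wle0 M -> wle0 X;
  wge0_summand : forall X M, direct_summand X M -> wge0 M -> wge0 X;
  wle0_wle1 : forall M, wle0 M -> shifted wle0 1 M;
  wge1_wge0 : forall M, shifted wge0 1 M -> wge0 M;
  weight_orthogonal : forall M N (f : mor M N),
    wle0 M -> shifted wge0 1 N -> f = 0;
  weight_decomposition : forall M,
    exists (A B : C) (u : mor A M) (v : mor M B) (d : mor B (tshift C A)),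
      [/\ exact_triangle u v d, wle0 A & shifted wge0 1 B]
}.

Variable w : weight_structure.

Definition wle n : C -> Prop := shifted (wle0 w) n.
Definition wge n : C -> Prop := shifted (wge0 w) n.

Definition in_heart M : Prop := wle0 w M /\ wge0 w M.

(* A -u-> M -v-> B -d-> A[1] is a weight filtration of M avoiding weights
   m, ..., n *)
Definition weight_filtration_avoiding m n M A B
    (u : mor A M) (v : mor M B) (d : mor B (tshift C A)) : Prop :=
  [/\ m <= n, exact_triangle u v d, wle (m - 1) A & wge (n + 1) B].

Definition without_weights m n M : Prop :=
  exists (A B : C) (u : mor A M) (v : mor M B) (d : mor B (tshift C A)),
    weight_filtration_avoiding m n u v d.

Definition in_wle0_neN1 M : Prop := wle0 w M /\ without_weights (-1) (-1) M.
Definition in_wge0_ne1 M : Prop := wge0 w M /\ without_weights 1 1 M.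

(* A heart object M has the weight filtrations 0 -> M -> M -> 0[1] and
   M -> M -> 0 -> M[1]; this makes the inclusions of the heart well defined. *)

Lemma comp0m X Y Z (f : mor X Y) : (0 : mor Y Z) \oc f = 0.
Proof.
by apply: (@addrI _ ((0 : mor Y Z) \oc f)); rewrite -compmDl !addr0.
Qed.

Lemma compm0 X Y Z (g : mor Y Z) : g \oc (0 : mor X Y) = 0.
Proof.
by apply: (@addrI _ (g \oc (0 : mor X Y))); rewrite -compmDr !addr0.
Qed.

Lemma shift0 X Y : fmap (tshift C) (0 : mor X Y) = 0.
Proof.
by apply: (@addrI _ (fmap (tshift C) (0 : mor X Y))); rewrite -shiftD !addr0.
Qed.

Lemma zero_objectE X : is_zero_object X <-> idm X = 0.
Proof.
split=> [[h _]|h]; first exact: h.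
split=> Y f; first by rewrite -(comp1m f) h comp0m.
by rewrite -(compm1 f) h compm0.
Qed.

Lemma to_zero X Z (f g : mor X Z) : is_zero_object Z -> f = g.
Proof. by case=> h _; rewrite (h _ f) (h _ g). Qed.

Lemma isomorphic_refl X : isomorphic X X.
Proof. by exists (idm X), (idm X); rewrite comp1m. Qed.

Lemma zero_isomorphic X Y :
  is_zero_object X -> is_zero_object Y -> isomorphic X Y.
Proof.
move=> hX hY; exists 0, 0.
by split; apply: to_zero.
Qed.

Lemma zero_shift X : is_zero_object X -> is_zero_object (tshift C X).
Proof.
by move=> /zero_objectE h; apply/zero_objectE; rewrite -fmap1 h shift0.
Qed.

Lemma isomorphic_zero X Y :
  isomorphic X Y -> is_zero_object Y -> is_zero_object X.
Proof.
move=> [f [g [gf _]]] [hY _]; apply/zero_objectE.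
by rewrite -gf (hY _ f) compm0.
Qed.

Lemma shift_faithful X Y (f g : mor X Y) :
  fmap (tshift C) f = fmap (tshift C) g -> f = g.
Proof.
have [eta eta_iso eta_nat] := shiftK C => fg.
have [k [_ ek]] := eta_iso X.
have := eta_nat _ _ f; have := eta_nat _ _ g; rewrite /= fg => <- E.
by rewrite -(compm1 f) -(compm1 g) -ek !compA E.
Qed.

Lemma zero_unshift X : is_zero_object X -> is_zero_object (tunshift C X).
Proof.
move=> hX; apply/zero_objectE/shift_faithful.
have [eta eta_iso _] := unshiftK C.
have hSU : is_zero_object (tshift C (tunshift C X)).
  by apply: (isomorphic_zero _ hX); exists (eta X); exact: eta_iso.
exact: to_zero.
Qed.

Lemma zero_shiftz n X : is_zero_object X -> is_zero_object (shiftz n X).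
Proof.
move=> hX; case: n => k; elim: k => //=.
- by move=> k; exact: zero_shift.
- exact: zero_unshift.
- by move=> k; exact: zero_unshift.
Qed.

Lemma zero_summand X M : is_zero_object X -> direct_summand X M.
Proof.
move=> hX; exists M, 0, (idm M), 0, (idm M); split.
- exact: to_zero.
- by rewrite comp1m.
- by rewrite compm0.
- by rewrite comp0m.
- by rewrite comp0m add0r comp1m.
Qed.

Lemma zero_wle n X : is_zero_object X -> wle n X.
Proof.
move=> hX; exists X; last exact: zero_isomorphic (zero_shiftz n hX).
have [A [B [u [v [d [_ hA _]]]]]] := weight_decomposition w X.
exact: wle0_summand (zero_summand A hX) hA.
Qed.

Lemma zero_wge n X : is_zero_object X -> wge n X.
Proof.
move=> hX; exists X; last exact: zero_isomorphic (zero_shiftz n hX).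
have [A [B [u [v [d [_ _ hB]]]]]] := weight_decomposition w X.
exact: wge0_summand (zero_summand B hX) (wge1_wge0 hB).
Qed.

Lemma heart_wle0_neN1 M : in_heart M -> in_wle0_neN1 M.
Proof.
move=> [leM geM]; split=> //; have [Z hZ] := has_zero_object C.
exists Z, M, 0, (idm M), 0; split=> //.
- apply/exact_rotate; rewrite shift0 oppr0.
  apply: (exact_iso (a := idm M) (b := idm M) (c := 0)) (exact_id M hZ).
  + by exists (idm M); rewrite comp1m.
  + by exists (idm M); rewrite comp1m.
  + exists 0; have hSZ := zero_shift hZ.
    by split; apply: to_zero.
  + by [].
  + by rewrite compm0 comp0m.
  + by rewrite compm0 comp0m.
- exact: zero_wle.
- by exists M => //; exact: isomorphic_refl.
Qed.

Lemma heart_wge0_ne1 M : in_heart M -> in_wge0_ne1 M.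
Proof.
move=> [leM geM]; split=> //; have [Z hZ] := has_zero_object C.
exists M, Z, (idm M), 0, 0; split=> //.
- exact: exact_id.
- by exists M => //; exact: isomorphic_refl.
- exact: zero_wge.
Qed.

Definition heart : category := full_subcat in_heart.
Definition cat_wle0_neN1 : category := full_subcat in_wle0_neN1.
Definition cat_wge0_ne1 : category := full_subcat in_wge0_ne1.

Definition iota_minus : functor heart cat_wle0_neN1 :=
  full_incl heart_wle0_neN1.
Definition iota_plus : functor heart cat_wge0_ne1 :=
  full_incl heart_wge0_ne1.

End WeightStructures.

(* Main.v *)
Require Import Defs.
From mathcomp Require Import all_boot all_order all_algebra.
From Stdlib Require Import ClassicalEpsilon FunctionalExtensionality.
Local Open Scope ring_scope.
Set Implicit Arguments.
Unset Strict Implicit.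
Unset Printing Implicit Defensive.
Import GRing.Theory.
Local Notation compA := Defs.compA.

(** Let [A -> M -> B -> A[1]] be a weight filtration avoiding weight [-1].
Since [A] has weights at most [-2], both [A] and [A[1]] have weights below [0],
so the long exact sequence of [Hom(-, N)] gives [Hom(B, N) = Hom(M, N)] for
every [N] of weights at least [0].  If moreover [M] has weights at most [0],
every map from [B] to an object of weights at least [1] vanishes on [M], hence
factors through [A[1]], hence is zero; as [wle0] is the left orthogonal of
[wge 1] ([wle0_orthogonal]), [B] lies in the heart.  Thus [M -> B] is a
universal arrow from [M] to the heart ([avoidingN1_heart],
[avoidingN1_universal]), and a choice of universal arrows is the same thing as
a left adjoint of the inclusion.  Part (b) is dual ([avoiding1_heart],
[avoiding1_couniversal]).

The composite of the adjoint with the inclusion is asserted to be equal, not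
just isomorphic, to the identity.  For this the universal arrow chosen at an
object of the heart must be its identity, which is legitimate because
[0 -> M -> M -> 0[1]] is a weight filtration of such an [M].  The lemma
[reflector] carries out this choice in an arbitrary category; [coreflector]
is [reflector] in the opposite category. *)

(** * Functors equal to the identity, and duality *)

Lemma eq_functor (C D : category) (o : C -> D)
    (m m' : forall X Y : C, mor X Y -> mor (o X) (o Y)) p q p' q' :
  (forall X Y f, m X Y f = m' X Y f) ->
  @Functor C D o m p q = @Functor C D o m' p' q'.
Proof.
move=> e; have {}e : m = m'.
  apply: functional_extensionality_dep => X.
  by apply: functional_extensionality_dep => Y; apply: functional_extensionality.
by subst m'; rewrite (proof_irrelevance _ p p') (proof_irrelevance _ q q').
Qed.

(** The pair formed by [F X] and [eta X] is compared with the pair [(X, idm X)]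
as a whole: an equation between morphisms would first need a transport along
[F X = X].  Once these families of pairs are identified, naturality of [eta]
reads [fmap F f = f]. *)
Lemma functor_eq_id (C : category) (F : functor C C)
    (eta : forall X : C, mor X (F X)) :
  (forall (X Y : C) (f : mor X Y), fmap F f \oc eta X = eta Y \oc f) ->
  (forall X : C, existT (mor X) (F X) (eta X) = existT (mor X) X (idm X)) ->
  F = functor_id C.
Proof.
case: F eta => o m p q eta /= nat_eta eta_id.
pose s X := existT (mor X) (o X) (eta X).
have s_id : s = fun X => existT (mor X) X (idm X).
  by apply: functional_extensionality_dep.
(* In [gen] the object map of the functor is a projection of the variable [t],
   so that the equation on [t] can be substituted. *)
have gen (t : forall X : C, {Y : C & mor X Y})
    (n : forall X Y : C, mor X Y -> mor (projT1 (t X)) (projT1 (t Y))) p' q' :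
    (forall X Y (f : mor X Y),
       n X Y f \oc projT2 (t X) = projT2 (t Y) \oc f) ->
    t = (fun X => existT (mor X) X (idm X)) ->
    @Functor C C (fun X => projT1 (t X)) n p' q' = functor_id C.
  move=> nat_t t_id; subst t; apply: eq_functor => X Y f.
  by have := nat_t X Y f; rewrite /= compm1 comp1m.
exact: (gen s m p q nat_eta s_id).
Qed.

Definition opposite (C : category) : category :=
  @Category C (fun X Y => mor Y X) (fun X => idm X)
    (fun _ _ _ g f => f \oc g)
    (fun _ _ f => compm1 f) (fun _ _ f => comp1m f)
    (fun _ _ _ _ h g f => esym (compA f g h)).

Definition functor_unop (C D : category)
    (F : functor (opposite C) (opposite D)) : functor C D :=
  @Functor C D F (fun X Y f => @fmap _ _ F Y X f)
    (fun X => @fmap1 _ _ F X) (fun X Y Z g f => @fmapM _ _ F Z Y X f g).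

(** Passing to opposite categories exchanges left and right adjoints; the new
bijections on morphisms are the inverses of the given ones. *)
Lemma left_adjoint_unop (C D : category)
    (F : functor (opposite C) (opposite D))
    (G : functor (opposite D) (opposite C)) :
  left_adjoint F G -> left_adjoint (functor_unop G) (functor_unop F).
Proof.
move=> [phi phi_bij phi_nat].
have inv Y X : exists psi, cancel (phi X Y) psi /\ cancel psi (phi X Y).
  by have [psi] := phi_bij X Y; exists psi.
pose psi Y X := sval (constructive_indefinite_description _ (inv Y X)).
have phiK Y X : cancel (phi X Y) (psi Y X).
  by rewrite /psi; case: constructive_indefinite_description => ? [].
have psiK Y X : cancel (psi Y X) (phi X Y).
  by rewrite /psi; case: constructive_indefinite_description => ? [].
exists psi => [Y X|Y Y' X X' a f b].
  by exists (phi X Y).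
apply: (can_inj (phiK Y' X')); rewrite psiK.
have := phi_nat X X' Y Y' b (psi Y X f) a; rewrite psiK /= => E.
by rewrite -compA -E compA.
Qed.

(** * Reflections onto full subcategories *)

Definition universal_arrow (C : category) (P : C -> Prop) (X Y : C)
    (v : mor X Y) : Prop :=
  forall Z, P Z -> forall f : mor X Z, exists! g : mor Y Z, g \oc v = f.

(** [R v] stands for any property that makes an arrow universal, such as being
part of a weight filtration; the units of the resulting adjunction keep this
property.  The hypothesis on identities allows the reflection to be strictly
the identity on [P]. *)
Lemma reflector (C : category) (P Q : C -> Prop)
    (sPQ : forall X, P X -> Q X) (R : forall X Y : C, mor X Y -> Prop) :
  (forall X, Q X -> exists Y (v : mor X Y), P Y /\ R X Y v) ->
  (forall X, P X -> R X X (idm X)) ->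
  (forall X Y (v : mor X Y), R X Y v -> universal_arrow P v) ->
  exists Gr : functor (full_subcat Q) (full_subcat P),
    [/\ left_adjoint Gr (full_incl sPQ),
        forall X, exists v : mor (sval X) (sval (Gr X)), R _ _ v
      & functor_comp Gr (full_incl sPQ) = functor_id (full_subcat P)].
Proof.
move=> exR R1 univR.
pose arrow (X : C) := {Y : full_subcat P & mor X (sval Y)}.
(* The second clause, over all proofs [PX], records that the identity has been
   chosen whenever possible, without a case distinction in the data. *)
have pick (X : full_subcat Q) : exists t : arrow (sval X),
    R _ _ (projT2 t) /\
    forall PX, t = existT _ (exist P (sval X) PX) (idm (sval X)).
  have [PX|nPX] := classic (P (sval X)).
    exists (existT _ (exist P (sval X) PX) (idm (sval X))).
    by split=> [|PX']; [exact: R1 | rewrite (proof_irrelevance _ PX' PX)].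
  have [Y [v [PY Rv]]] := exR _ (svalP X).
  by exists (existT _ (exist P Y PY) v); split.
pose s X := sval (constructive_indefinite_description _ (pick X)).
have sR X : R _ _ (projT2 (s X)).
  by rewrite /s; case: constructive_indefinite_description => ? [].
have s_id X PX : s X = existT _ (exist P (sval X) PX) (idm (sval X)).
  by rewrite /s; case: constructive_indefinite_description => ? [].
pose o X := projT1 (s X); pose eta X : mor (sval X) (sval (o X)) := projT2 (s X).
have fac X (Z : full_subcat P) (f : mor (sval X) (sval Z)) :
    exists g : mor (sval (o X)) (sval Z), g \oc eta X = f.
  by have [g [E _]] := univR _ _ _ (sR X) _ (svalP Z) f; exists g.
have eta_epi X (Z : full_subcat P) (g g' : mor (sval (o X)) (sval Z)) :
    g \oc eta X = g' \oc eta X -> g = g'.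
  move=> E; have [h [_ U]] := univR _ _ _ (sR X) _ (svalP Z) (g' \oc eta X).
  by rewrite -(U _ E) -(U _ erefl).
pose psi X Z f : mor (o X) Z :=
  sval (constructive_indefinite_description _ (fac X Z f)).
have psiE X Z f : (psi X Z f : mor (sval (o X)) (sval Z)) \oc eta X = f.
  by rewrite /psi; case: constructive_indefinite_description.
pose m X Y (f : mor X Y) := psi X (o Y) (eta Y \oc f).
have mE X Y (f : mor X Y) :
    (m X Y f : mor (sval (o X)) (sval (o Y))) \oc eta X = eta Y \oc f.
  exact: psiE.
have m1 X : m X X (idm X) = idm (o X).
  by apply: eta_epi; rewrite mE comp1m compm1.
have mM X Y Z (g : mor Y Z) (f : mor X Y) :
    m X Z (g \oc f) = m Y Z g \oc m X Y f.
  by apply: eta_epi; rewrite mE /= -compA mE !compA mE.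
pose Gr := @Functor (full_subcat Q) (full_subcat P) o m m1 mM.
exists Gr; split.
- exists (fun X Y (g : mor (o X) Y) =>
            (g : mor (sval (o X)) (sval Y)) \oc eta X).
    move=> X Y; exists (psi X Y) => f; last exact: psiE.
    by apply: eta_epi; rewrite psiE.
  by move=> X X' Y Y' a f b /=; rewrite -compA mE !compA.
- by move=> X; exists (eta X); exact: sR.
- pose eta' (X : full_subcat P) : mor X (functor_comp Gr (full_incl sPQ) X) :=
    eta (full_incl sPQ X).
  apply: (functor_eq_id (eta := eta')) => [X Y f|[X PX]].
    exact: (mE (full_incl sPQ X) (full_incl sPQ Y) f).
  have := s_id (full_incl sPQ (exist P X PX)) PX.
  by rewrite /eta' /= /eta /o; move: (s _) => t ->.
Qed.

Definition couniversal_arrow (C : category) (P : C -> Prop) (X Y : C)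
    (u : mor X Y) : Prop :=
  forall Z, P Z -> forall f : mor Z Y, exists! g : mor Z X, u \oc g = f.

(** This is [reflector] in the opposite category: the full subcategory of an
opposite is convertible to the opposite of the full subcategory. *)
Lemma coreflector (C : category) (P Q : C -> Prop)
    (sPQ : forall X, P X -> Q X) (R : forall X Y : C, mor X Y -> Prop) :
  (forall Y, Q Y -> exists X (u : mor X Y), P X /\ R X Y u) ->
  (forall X, P X -> R X X (idm X)) ->
  (forall X Y (u : mor X Y), R X Y u -> couniversal_arrow P u) ->
  exists Gr : functor (full_subcat Q) (full_subcat P),
    [/\ left_adjoint (full_incl sPQ) Gr,
        forall X, exists u : mor (sval (Gr X)) (sval X), R _ _ u
      & functor_comp Gr (full_incl sPQ) = functor_id (full_subcat P)].
Proof.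
move=> exR R1 univR.
have [F [adj FR F_id]] :=
  @reflector (opposite C) P Q sPQ (fun X Y u => R Y X u) exR R1
    (fun X Y u => univR Y X u).
exists (@functor_unop (full_subcat Q) (full_subcat P) F); split=> //.
  exact: (@left_adjoint_unop (full_subcat Q) (full_subcat P) _ _ adj).
(* Composing before or after passing to opposites gives the same maps; only the
   proofs of the functor laws differ. *)
transitivity (@functor_unop (full_subcat P) (full_subcat P)
   (@functor_comp (full_subcat (C := opposite C) P) _ _ F
      (full_incl (C := opposite C) sPQ))).
  exact: eq_functor.
by rewrite F_id.
Qed.

(** * Exactness in a triangulated category *)

Section Triangulated.
Variable C : triangulated_category.
Local Notation S := (tshift C).
Local Notation U := (tunshift C).

Lemma compmN (X Y Z : C) (g : mor Y Z) (f : mor X Y) :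
  g \oc (- f) = - (g \oc f).
Proof. by apply: (@addrI _ (g \oc f)); rewrite -compmDr !subrr compm0. Qed.

Lemma compNm (X Y Z : C) (g : mor Y Z) (f : mor X Y) :
  (- g) \oc f = - (g \oc f).
Proof. by apply: (@addrI _ (g \oc f)); rewrite -compmDl !subrr comp0m. Qed.

Lemma unshift_faithful (X Y : C) (f g : mor X Y) :
  fmap U f = fmap U g -> f = g.
Proof.
have [eta eta_iso eta_nat] := unshiftK C => fg.
have [k [_ ek]] := eta_iso X.
have := eta_nat _ _ f; have := eta_nat _ _ g; rewrite /= fg => <- E.
by rewrite -(compm1 f) -(compm1 g) -ek !compA E.
Qed.

(** The preimage of [f] is its conjugate under [tunshift]: it has the same image
as [f] under the faithful functor [tunshift]. *)
Lemma shift_full (X Y : C) (f : mor (S X) (S Y)) :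
  exists g : mor X Y, f = fmap S g.
Proof.
have [eta eta_iso eta_nat] := shiftK C.
have [kX [kXe ekX]] := eta_iso X; have [kY [kYe ekY]] := eta_iso Y.
exists (eta Y \oc fmap U f \oc kX); apply: unshift_faithful.
have := eta_nat _ _ (eta Y \oc fmap U f \oc kX).
rewrite /= -[LHS]compA kXe compm1 => /(congr1 (fun h => kY \oc h)).
by rewrite !compA kYe !comp1m.
Qed.

Section Triangle.
Variables (X Y Z : C) (u : mor X Y) (v : mor Y Z) (d : mor Z (S X)).
Hypothesis uvd : exact_triangle u v d.

Lemma exact_comp0 : v \oc u = 0.
Proof.
have [O hO] := has_zero_object C.
have E : u \oc idm X = u \oc idm X by [].
have [c [<- _]] := exact_complete (exact_id X hO) uvd E.
by rewrite compm0.
Qed.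

(** Exactness of [Hom(-, N)]: complete [(0, f)] to a morphism from the given
triangle to [0 -> N -> N -> 0[1]]. *)
Lemma exact_factor (N : C) (f : mor Y N) :
  f \oc u = 0 -> exists g : mor Z N, g \oc v = f.
Proof.
move=> fu0; have [O hO] := has_zero_object C.
have tN : exact_triangle (0 : mor O N) (idm N) (0 : mor N (S O)).
  by apply/exact_rotate; rewrite shift0 oppr0; apply/exact_id/zero_shift.
have E : f \oc u = 0 \oc (0 : mor X O) by rewrite fu0 comp0m.
have [g [gv _]] := exact_complete uvd tN E.
by exists g; rewrite gv comp1m.
Qed.

(** Exactness of [Hom(N, -)].  The completion axiom produces the third component
of a morphism of triangles, so both triangles are rotated first; the lift is
then found up to a shift, whence the need for [shift_full]. *)
Lemma exact_lift (N : C) (f : mor N Y) :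
  v \oc f = 0 -> exists g : mor N X, u \oc g = f.
Proof.
move=> vf0; have [O hO] := has_zero_object C.
have /exact_rotate tN := exact_id N hO; have /exact_rotate tuvd := uvd.
have E : (0 : mor O Z) \oc (0 : mor N O) = v \oc f by rewrite vf0 comp0m.
have [c [_]] := exact_complete tN tuvd E.
have [g ->] := shift_full c.
rewrite compmN compNm fmap1 compm1 -fmapM => /oppr_inj /shift_faithful ->.
by exists g.
Qed.

End Triangle.

(** The complement of [X] is the cone [Z] of [s].  The connecting map [e] of the
cone vanishes because [s[1]] is a split monomorphism that kills it, hence
[q : A -> Z] is epi, and the idempotent [1 - s r] factors through [q]. *)
Lemma retract_summand (X A : C) (s : mor X A) (r : mor A X) :
  r \oc s = idm X -> direct_summand X A.
Proof.
move=> rs; have [Z [q [e sqe]]] := exact_cone s.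
have /exact_rotate qes := sqe; have /exact_rotate esq := qes.
have e0 : e = 0.
  have := exact_comp0 esq; rewrite compNm => /eqP; rewrite oppr_eq0 => /eqP se.
  by rewrite -(comp1m e) -fmap1 -rs fmapM -compA se compm0.
have q_epi (N : C) (f : mor Z N) : f \oc q = 0 -> f = 0.
  by move=> /(exact_factor qes) [g <-]; rewrite e0 compm0.
have qs : q \oc s = 0 := exact_comp0 sqe.
have [|t tq] := exact_factor sqe (f := idm A - s \oc r).
  by rewrite compmDl compNm -compA rs compm1 comp1m subrr.
exists Z, s, t, r, q; split=> //.
- apply/eqP; rewrite -subr_eq0; apply/eqP/q_epi.
  rewrite compmDl compNm -compA tq compmDr compmN compA qs comp0m.
  by rewrite compm1 comp1m subr0 subrr.
- apply: q_epi; rewrite -compA tq compmDr compmN compA rs comp1m compm1.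
  by rewrite subrr.
- by rewrite tq addrC subrK.
Qed.

End Triangulated.

(** * Orthogonality for a weight structure *)

Section Weights.
Variables (C : triangulated_category) (w : weight_structure C).
Local Notation S := (tshift C).

Lemma wle0_retract (X A : C) (s : mor X A) (r : mor A X) :
  r \oc s = idm X -> wle0 w A -> wle0 w X.
Proof. by move=> /retract_summand; exact: wle0_summand. Qed.

Lemma wge0_retract (X A : C) (s : mor X A) (r : mor A X) :
  r \oc s = idm X -> wge0 w A -> wge0 w X.
Proof. by move=> /retract_summand; exact: wge0_summand. Qed.

Lemma wleE0 (X : C) : wle w 0 X -> wle0 w X.
Proof. by case=> A hA [s [r [rs _]]]; exact: wle0_retract rs hA. Qed.

Lemma wgeE0 (X : C) : wge w 0 X -> wge0 w X.
Proof. by case=> A hA [s [r [rs _]]]; exact: wge0_retract rs hA. Qed.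

Lemma shift_wge1 (N : C) : wge0 w N -> wge w 1 (S N).
Proof. by move=> hN; exists N => //; exact: isomorphic_refl. Qed.

Lemma shift_wge0 (N : C) : wge0 w N -> wge0 w (S N).
Proof. by move=> /shift_wge1; exact: wge1_wge0. Qed.

(** If every map from [X] to [wge 1] is zero, then the map [X -> B] in a weight
decomposition [A -> X -> B -> A[1]] of [X] is zero, so [X] is a retract
of [A]. *)
Lemma wle0_orthogonal (X : C) :
  (forall (N : C) (f : mor X N), wge w 1 N -> f = 0) -> wle0 w X.
Proof.
move=> X0; have [A [B [u [v [d [uvd hA hB]]]]]] := weight_decomposition w X.
have v0 : v = 0 := X0 _ v hB.
have [|s us] := exact_lift uvd (f := idm X); first by rewrite v0 comp0m.
exact: wle0_retract us hA.
Qed.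

(** Here the object to decompose is [X[1]], which comes out as a retract of an
object [Y[1]] with [Y] in [wge0]; fullness of the shift gives back a retraction
of [Y] onto [X]. *)
Lemma wge0_orthogonal (X : C) :
  (forall (N : C) (f : mor N (S X)), wle0 w N -> f = 0) -> wge0 w X.
Proof.
move=> X0; have [A [B [u [v [d [uvd hA hB]]]]]] := weight_decomposition w (S X).
have u0 : u = 0 := X0 _ u hA.
have [|r rv] := exact_factor uvd (f := idm (S X)); first by rewrite u0 compm0.
have [Y hY [a [b [ba _]]]] := hB.
have [s Es] := shift_full (a \oc v : mor (S X) (S Y)).
have [t Et] := shift_full (r \oc b : mor (S Y) (S X)).
apply: (wge0_retract (s := s) (r := t)) hY.
apply: shift_faithful; rewrite fmapM fmap1 -Es -Et.
by rewrite compA -(compA r) ba compm1.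
Qed.

(** The weights of [A[1]] are at most [-1].  After one more shift, orthogonality
applies to [A[2] -> N[1]]. *)
Lemma orthogonal_wleN2_shift (A N : C) (f : mor (S A) N) :
  wle w (-1 - 1) A -> wge0 w N -> f = 0.
Proof.
case=> X hX [a [b [ba _]]] hN; apply: shift_faithful; rewrite shift0.
(* [A] is isomorphic to [U (U X)] with [X] in [wle0], so that [S (S A)] is a
   retract of [X]. *)
have hSSA : wle0 w (S (S A)).
  have [eta eta_iso _] := unshiftK C.
  have [k1 [k1e _]] := eta_iso (tunshift C X).
  have [k2 [k2e _]] := eta_iso X.
  apply: (wle0_retract
    (s := eta X \oc fmap S (eta (tunshift C X) \oc fmap S a))
    (r := fmap S (fmap S b \oc k1) \oc k2)) hX.
  rewrite compA -(compA _ k2) k2e compm1 -fmapM compA -(compA _ k1) k1e compm1.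
  by rewrite -fmapM ba !fmap1.
exact: weight_orthogonal hSSA (shift_wge1 hN).
Qed.

Lemma orthogonal_wleN2 (A N : C) (f : mor A N) :
  wle w (-1 - 1) A -> wge0 w N -> f = 0.
Proof.
move=> hA hN; apply: shift_faithful; rewrite shift0.
exact: orthogonal_wleN2_shift hA (shift_wge0 hN).
Qed.

(** By fullness of the shift, a map [N[1] -> Y[2]] is the shift of a map
[N -> Y[1]], to which orthogonality applies. *)
Lemma orthogonal_wge2_shift (N B : C) (f : mor (S N) B) :
  wle0 w N -> wge w (1 + 1) B -> f = 0.
Proof.
move=> hN [Y hY [a [b [ba _]]]].
have [g Eg] := shift_full (a \oc f : mor (S N) (S (S Y))).
have g0 : g = 0 := weight_orthogonal g hN (shift_wge1 hY).
by rewrite -(comp1m f) -ba -compA Eg g0 shift0 compm0.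
Qed.

Lemma orthogonal_wge2 (N B : C) (f : mor N B) :
  wle0 w N -> wge w (1 + 1) B -> f = 0.
Proof.
move=> hN [Y hY [a iso_a]]; apply: (weight_orthogonal (w := w)) => //.
by exists (S Y); [exact: shift_wge0 | exists a].
Qed.

(** * The term of weight zero *)

Section AvoidingN1.
Variables (M A B : C) (u : mor A M) (v : mor M B) (d : mor B (S A)).
Hypothesis uvd : weight_filtration_avoiding w (-1) (-1) u v d.

(** [B] is an extension of [A[1]] by [M], so it is left orthogonal to whatever
both are. *)
Lemma avoidingN1_heart : wle0 w M -> in_heart w B.
Proof.
case: uvd => _ tri hA hB hM; split; last exact: wgeE0.
apply: wle0_orthogonal => N f hN.
have [|h <-] := exact_factor ((exact_rotate _ _ _).1 tri) (f := f).
  exact: weight_orthogonal hM hN.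
by rewrite (orthogonal_wleN2_shift h hA (wge1_wge0 hN)) comp0m.
Qed.

Lemma avoidingN1_universal : universal_arrow (in_heart w) v.
Proof.
case: uvd => _ tri hA _ N [_ hN] f.
have [|g gv] := exact_factor tri (f := f); first exact: orthogonal_wleN2 hA hN.
exists g; split=> // g' g'v; apply/eqP; rewrite -subr_eq0; apply/eqP.
have [|h <-] := exact_factor ((exact_rotate _ _ _).1 tri) (f := g - g').
  by rewrite compmDl compNm gv g'v subrr.
by rewrite (orthogonal_wleN2_shift h hA hN) comp0m.
Qed.

End AvoidingN1.

Section Avoiding1.
Variables (M A B : C) (u : mor A M) (v : mor M B) (d : mor B (S A)).
Hypothesis uvd : weight_filtration_avoiding w 1 1 u v d.

(** [A[1]] is an extension of [M[1]] by [B], so it is right orthogonal to whatever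
both are. *)
Lemma avoiding1_heart : wge0 w M -> in_heart w A.
Proof.
case: uvd => _ tri hA hB hM; split; first exact: wleE0.
apply: wge0_orthogonal => N f hN.
have tri' := (exact_rotate _ _ _).1 ((exact_rotate _ _ _).1 tri).
have [|h <-] := exact_lift tri' (f := f).
  exact: weight_orthogonal hN (shift_wge1 hM).
by rewrite (orthogonal_wge2 h hN hB) compm0.
Qed.

(** Two lifts of [f] differ by a map that factors through [B[-1]]; to avoid the
inverse shift, the argument is applied to the shifted difference, which factors
through [B]. *)
Lemma avoiding1_couniversal : couniversal_arrow (in_heart w) u.
Proof.
case: uvd => _ tri _ hB N [hN _] f.
have [|g ug] := exact_lift tri (f := f); first exact: orthogonal_wge2 hN hB.
exists g; split=> // g' ug'; apply/eqP; rewrite -subr_eq0; apply/eqP.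
have tri' := (exact_rotate _ _ _).1 ((exact_rotate _ _ _).1 tri).
apply: shift_faithful; rewrite shift0.
have [|h <-] := exact_lift tri' (f := fmap S (g - g')).
  by rewrite compNm -fmapM compmDr compmN ug ug' subrr shift0 oppr0.
by rewrite (orthogonal_wge2_shift h hN hB) compm0.
Qed.

End Avoiding1.

Lemma heart_filtrationN1 (M : C) : in_heart w M ->
  exists (A : C) (u : mor A M) (d : mor M (S A)),
    weight_filtration_avoiding w (-1) (-1) u (idm M) d.
Proof.
move=> [_ geM]; have [O hO] := has_zero_object C.
exists O, 0, 0; split=> //; last by exists M => //; exact: isomorphic_refl.
  by apply/exact_rotate; rewrite shift0 oppr0; apply/exact_id/zero_shift.
exact: zero_wle.
Qed.

Lemma heart_filtration1 (M : C) : in_heart w M ->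
  exists (B : C) (v : mor M B) (d : mor B (S M)),
    weight_filtration_avoiding w 1 1 (idm M) v d.
Proof.
move=> [leM _]; have [O hO] := has_zero_object C.
exists O, 0, 0; split=> //; last exact: zero_wge.
  exact: exact_id.
by exists M => //; exact: isomorphic_refl.
Qed.

End Weights.

Theorem proposition2p2 (C : triangulated_category) (w : weight_structure C) :
  (exists Gr0 : functor (cat_wle0_neN1 w) (heart w),
    [/\ left_adjoint Gr0 (iota_minus w),
        forall M : cat_wle0_neN1 w,
          exists (A : C) (u : mor A (sval M)) (v : mor (sval M) (sval (Gr0 M)))
                 (d : mor (sval (Gr0 M)) (tshift C A)),
            weight_filtration_avoiding w (-1) (-1) u v d
      & functor_comp Gr0 (iota_minus w) = functor_id (heart w)])
  /\
  (exists Gr0 : functor (cat_wge0_ne1 w) (heart w),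
    [/\ left_adjoint (iota_plus w) Gr0,
        forall M : cat_wge0_ne1 w,
          exists (B : C) (u : mor (sval (Gr0 M)) (sval M)) (v : mor (sval M) B)
                 (d : mor B (tshift C (sval (Gr0 M)))),
            weight_filtration_avoiding w 1 1 u v d
      & functor_comp Gr0 (iota_plus w) = functor_id (heart w)]).
Proof.
split.
  have [||M B v [A [u [d fil]]]|Gr0 [adj GrR Gr_id]] :=
      reflector (@heart_wle0_neN1 C w)
        (R := fun M B v => exists (A : C) (u : mor A M) (d : mor B (tshift C A)),
                weight_filtration_avoiding w (-1) (-1) u v d).
  - move=> M [hM [A [B [u [v [d fil]]]]]].
    by exists B, v; split; [exact: avoidingN1_heart fil hM | exists A, u, d].
  - exact: heart_filtrationN1.
  - exact: avoidingN1_universal fil.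
  exists Gr0; split=> // M.
  by have [v [A [u [d fil]]]] := GrR M; exists A, u, v, d.
have [||A M u [B [v [d fil]]]|Gr0 [adj GrR Gr_id]] :=
    coreflector (@heart_wge0_ne1 C w)
      (R := fun A M u => exists (B : C) (v : mor M B) (d : mor B (tshift C A)),
              weight_filtration_avoiding w 1 1 u v d).
- move=> M [hM [A [B [u [v [d fil]]]]]].
  by exists A, u; split; [exact: avoiding1_heart fil hM | exists B, v, d].
- exact: heart_filtration1.
- exact: avoiding1_couniversal fil.
exists Gr0; split=> // M.
by have [u [B [v [d fil]]]] := GrR M; exists B, u, v, d.
Qed.
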